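(* Let $\Phi$ be the root system of type $F_4$, let $\mathbb{F}_q$ be a finite field of sufficiently large characteristic, let $\mathfrak{n}$ be the nilradical of a Borel subalgebra of the simple Lie algebra of type $F_4$ over $\mathbb{F}_q$, let $N=\exp(\mathfrak{n})$, and let $S\subset\mathfrak{n}^*$ be the set of linear forms $\lambda$ such that $\operatorname{rk}A_{\lambda,\gamma}=\operatorname{rk}B_{\lambda,\gamma}$ for every $\gamma\in\operatorname{supp}(\lambda)$ (notation in the context). Then for any coadjoint orbit of $N$ on $\mathfrak{n}^*$ there exists a unique linear form $\lambda\in S$ lying on this orbit.
   Context: Let $\mathfrak{g}$ be the simple finite-dimensional Lie algebra of type $\Phi=F_4$ over $\mathbb{F}_q$, where the characteristic $p$ is assumed sufficiently large; $\mathfrak{b}$ a Borel subalgebra, $\Phi^+$ the corresponding positive roots, $\mathfrak{n}$ the nilradical of $\mathfrak{b}$, with basis of root vectors $\{e_\alpha,\ \alpha\in\Phi^+\}$, $N=\exp(\mathfrak{n})$ the corresponding unipotent group, and $\mathfrak{n}^*$ the dual space with dual basis $\{e_\alpha^*\}$. The coadjoint action of $N$ on $\mathfrak{n}^*$ is $$(\exp(x)\cdot\lambda)(y)=\lambda(\exp(-\mathrm{ad}_x)(y))=\lambda(y)-\lambda([x,y])+\tfrac1{2!}\lambda([x,[x,y]])-\dots,\quad x,y\in\mathfrak{n},\ \lambda\in\mathfrak{n}^*;$$ its orbits are the coadjoint orbits. The simple roots are $\alpha_1=\varepsilon_2-\varepsilon_3$, $\alpha_2=\varepsilon_3-\varepsilon_4$,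 $\alpha_3=\varepsilon_4$, $\alpha_4=\frac12(\varepsilon_1-\varepsilon_2-\varepsilon_3-\varepsilon_4)$, where $\varepsilon_1,\dots,\varepsilon_4$ is the standard basis of $\mathbb{R}^4$. The linear order $\succ$ on $\Phi^+$ is lexicographic: $\sum a_i\alpha_i\succ\sum b_i\alpha_i$ if $a_i>b_i$ for the smallest index $i$ with $a_i\ne b_i$. The support of $\lambda\in\mathfrak{n}^*$ is $\operatorname{supp}(\lambda)=\{\alpha\in\Phi^+:\lambda(e_\alpha)\neq0\}$. For $\lambda\in\mathfrak{n}^*$, $\gamma\in\Phi^+$ define the matrices $$A_{\lambda,\gamma}=(\lambda([e_\alpha,e_\beta]))_{\alpha\in\Phi^+,\ \alpha\succeq\gamma;\ \beta\in\Phi^+},\qquad B_{\lambda,\gamma}=(\lambda([e_\alpha,e_\beta]))_{\alpha\in\Phi^+,\ \alpha\succ\gamma;\ \beta\in\Phi^+},$$ with rows indexed by $\alpha$ and columns by all $\beta\in\Phi^+$ (an empty matrix has rank $0$). *)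

(* Defs.v *)
From HB Require Import structures.
From mathcomp Require Import all_boot all_order all_algebra.

Set Implicit Arguments.
Unset Strict Implicit.
Unset Printing Implicit Defensive.

Import Order.TTheory GRing.Theory Num.Theory.
Local Open Scope ring_scope.

(* 1-based, as in the usual notation: the standard basis is eps 1, ..., eps 4. *)
Definition eps (k : nat) : 'rV[rat]_4 := delta_mx 0 (inord k.-1).

Definition dot (u v : 'rV[rat]_4) : rat := \sum_(i < 4) u 0 i * v 0 i.

Definition signs : seq rat := [:: 1; -1].

Definition pm (i j : nat) : seq 'rV[rat]_4 :=
  [seq s *: eps i + t *: eps j | s <- signs, t <- signs].

(* +-eps_i, +-eps_i +- eps_j for i < j, and (+-eps_1 +-eps_2 +-eps_3 +-eps_4)/2 *)
Definition F4_roots : seq 'rV[rat]_4 :=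
  [seq s *: eps i | s <- signs, i <- iota 1 4]
  ++ flatten [seq pm i j | i <- iota 1 4, j <- iota i.+1 (4 - i)]
  ++ [seq 2^-1 *: (u + v) | u <- pm 1 2, v <- pm 3 4].

Definition root := seq_sub F4_roots.

(* 0-based, unlike eps: alpha_1, ..., alpha_4 have indices 0, ..., 3. *)
Definition simple_root (i : 'I_4) : 'rV[rat]_4 :=
  nth 0 [:: eps 2 - eps 3; eps 3 - eps 4; eps 4;
            2^-1 *: (eps 1 - eps 2 - eps 3 - eps 4)] i.

(* coordinates a_1, ..., a_4 of v in the basis of simple roots *)
Definition coords (v : 'rV[rat]_4) : 'rV[rat]_4 :=
  v *m invmx (\matrix_(i < 4) simple_root i).

Definition positive (v : 'rV[rat]_4) : bool := [forall i, 0 <= coords v 0 i].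

Definition pos_root := {a : root | positive (ssval a)}.

Definition vec (a : pos_root) : 'rV[rat]_4 := ssval (val a).

Definition root_gt (a b : pos_root) : bool :=
  [exists i : 'I_4, (coords (vec a) 0 i > coords (vec b) 0 i)
     && [forall j : 'I_4, (j < i)%N ==> (coords (vec a) 0 j == coords (vec b) 0 j)]].

Definition root_ge (a b : pos_root) : bool := (a == b) || root_gt a b.

(* <a, b^vee> = 2 (a, b) / (b, b), an integer when a and b are roots *)
Definition cartan (a b : 'rV[rat]_4) : rat := 2 * dot a b / dot b b.

(* If a = \sum_i a_i alpha_i then
   a^vee = 2 a / (a, a) = \sum_i (a_i (alpha_i, alpha_i) / (a, a)) alpha_i^vee,
   with integer coefficients when a is a root. *)
Definition coroot_coord (a : 'rV[rat]_4) (i : 'I_4) : rat :=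
  coords a 0 i * dot (simple_root i) (simple_root i) / dot a a.

(* The largest r such that b - r a is a root, for linearly independent roots
   a and b; root strings in F4 have at most 3 elements, so r <= 2. *)
Definition string_below (a b : 'rV[rat]_4) : nat :=
  \max_(r < 4 | b - a *+ r \in F4_roots) r.

Record lieAlgebra (F : fieldType) := LieAlgebra {
  lie_sort :> vectType F;
  bracket : lie_sort -> lie_sort -> lie_sort;
  bracket_linearl : forall y, linear (bracket ^~ y);
  bracket_linearr : forall x, linear (bracket x);
  bracketxx : forall x, bracket x x = 0;
  bracket_jacobi : forall x y z,
    bracket x (bracket y z) + bracket y (bracket z x)
      + bracket z (bracket x y) = 0 }.

(* The simple Lie algebra of type F4 over F is the Lie algebra with a
   Chevalley basis (h_i, x_a) of type F4.  The rational numbers embedded in F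
   by ratr are all integers. *)
Record chevalley_basis (F : fieldType) (g : lieAlgebra F) := ChevalleyBasis {
  chev_h : 'I_4 -> g;
  chev_x : root -> g;
  chev_basis : basis_of {:g} (codom chev_h ++ codom chev_x);
  chev_hh : forall i j, bracket (chev_h i) (chev_h j) = 0;
  chev_hx : forall i (a : root),
    bracket (chev_h i) (chev_x a)
      = ratr (cartan (ssval a) (simple_root i)) *: chev_x a;
  chev_opp : forall a b : root, ssval a + ssval b = 0 ->
    bracket (chev_x a) (chev_x b)
      = \sum_(i < 4) ratr (coroot_coord (ssval a) i) *: chev_h i;
  chev_add : forall a b c : root, ssval a + ssval b = ssval c ->
    exists s : bool, bracket (chev_x a) (chev_x b)
      = ((-1) ^+ s * (string_below (ssval a) (ssval b)).+1%:R) *: chev_x c;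
  chev_0 : forall a b : root,
    ssval a + ssval b != 0 -> ssval a + ssval b \notin F4_roots ->
    bracket (chev_x a) (chev_x b) = 0 }.

Section Coadjoint.
Variables (F : fieldType) (g : lieAlgebra F) (C : chevalley_basis g).

(* The nilradical of the Borel subalgebra spanned by the h_i and the x_a, a > 0 *)
Definition nilradical : {vspace g} :=
  <<[seq chev_x C (val a) | a : pos_root]>>%VS.

Local Notation n := (subvs_of nilradical).

Definition nbracket (x y : n) : n :=
  vsproj nilradical (bracket (vsval x) (vsval y)).

Definition ndual := 'Hom(n, F^o).

(* exp f = \sum_k f^k / k!, for f a nilpotent endomorphism of n (f^k then
   vanishes for k >= \dim n). *)
Definition nexp (f : n -> n) (y : n) : n :=
  \sum_(k < (\dim nilradical).+1) (k`!%:R)^-1 *: iter k f y.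

(* (exp x . l)(y) = l (exp (- ad_x) y) *)
Definition coadjoint (x : n) (l : ndual) : ndual :=
  linfun (fun y : n => l (nexp (fun z => - nbracket x z) y)).

Definition coadjoint_orbit (l m : ndual) : Prop :=
  exists x : n, m = coadjoint x l.

(* Root vectors e_a are fixed only up to a nonzero scalar. *)
Definition root_vectors (e : pos_root -> n) : Prop :=
  forall a, e a != 0 /\ vsval (e a) \in <[chev_x C (val a)]>%VS.

Variable e : pos_root -> n.

Definition supp (l : ndual) : {set pos_root} := [set a | l (e a) != 0].

Definition bracket_mx (l : ndual) (D : {set pos_root}) :
    'M[F]_(#|D|, #|{: pos_root}|) :=
  \matrix_(i, j) l (nbracket (e (enum_val i)) (e (enum_val j))).

Definition Amx (l : ndual) (c : pos_root) := bracket_mx l [set a | root_ge a c].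

Definition Bmx (l : ndual) (c : pos_root) := bracket_mx l [set a | root_gt a c].

Definition in_S (l : ndual) : Prop :=
  forall c, c \in supp l -> \rank (Amx l c) = \rank (Bmx l c).

End Coadjoint.

(* Main.v *)
Require Import Defs.
From HB Require Import structures.
From mathcomp Require Import all_boot all_order all_algebra.
From mathcomp Require Import lra zify.

(** Let U a be the span of the root vectors e b with b above a.  The order is
    compatible with addition of roots, so U a is an ideal, and it contains the
    bracket of e a with anything.  The two ranks at a agree exactly when every y
    with l([e b, y]) = 0 for all b above a also has l([e a, y]) = 0
    (same_rank_ad, not_same_rank_ad): the infinitesimal stabiliser of the
    restriction of l to U a then fixes l(e a) as well.  Both ranks at a depend
    only on this restriction (same_rank_local), which allows working from the
    highest root downwards.

    Existence: where the ranks at a differ, some exp(y) fixes the values above a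
    and brings the value at a to 0 (clear_coordinate); where they agree, the
    value at a is left alone.  Uniqueness: let l and exp(x) l both be in normal
    form and agree above a.  Then x is in the infinitesimal stabiliser of the
    restriction of l to U a (hom_ad_eq0).  If the ranks at a agree, exp(x)
    therefore fixes l(e a); if they differ, both forms vanish at e a.

    The orbits are defined by exponentials alone, so all this needs the product
    of two exponentials to be an exponential (Exp_comp).  Here the grading of n
    replaces the Baker-Campbell-Hausdorff formula.  Let delta be a derivation
    acting on the root vectors with nonzero, pairwise distinct weights.  Then
    exp(ad x) delta = (delta - ad u) exp(ad x) for an explicit u = twist x, and
    every u in n is of this form (twist_surj).  A unitriangular g such that
    g delta = (delta - ad u) g is determined by u, because the weights are
    distinct (unitriangular_intertwiner_unique).  A product of two exponentials
    satisfies such a relation for some u, so it is the exponential of any z with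
    twist z = u.

    The bound on the characteristic keeps the factorials in the series, the
    weights and their differences invertible.  Integer weights exist because finitely
    many nonzero rational vectors can be avoided by the kernel of a linear form
    (integral_weight). *)
Set Implicit Arguments.
Unset Strict Implicit.
Unset Printing Implicit Defensive.

Import Order.TTheory GRing.Theory Num.Theory.
Local Open Scope ring_scope.

(** * Truncated exponentials *)

Section Exponential.
Variables (F : fieldType) (V : lmodType F).

Definition divpow (f : V -> V) (k : nat) (v : V) : V :=
  (k`!%:R)^-1 *: iter k f v.

Definition texp (N : nat) (f : V -> V) (v : V) : V :=
  \sum_(k < N.+1) divpow f k v.

(** Rearranges the product of two series with finitely many nonzero terms. *)
Lemma sum_antidiagonal (T : nat -> nat -> V) (a b M : nat) :
  (forall k j, (a <= k)%N || (b <= j)%N -> T k j = 0) -> (a + b <= M)%N ->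
  \sum_(n < M) \sum_(k < n.+1) T k (n - k)%N
    = \sum_(k < a) \sum_(j < b) T k j.
Proof.
move=> T0 leM.
have -> : \sum_(k < a) \sum_(j < b) T k j
    = \sum_(k < M | (k < a)%N) \sum_(j < M | (j < b)%N) T k j.
  rewrite (big_ord_widen M (fun k => \sum_(j < b) T k j)); last first.
    by apply: leq_trans leM; apply: leq_addr.
  apply: eq_bigr => k _; rewrite (big_ord_widen M (T k)) //.
  by apply: leq_trans leM; apply: leq_addl.
have -> : \sum_(n < M) \sum_(k < n.+1) T k (n - k)%N
    = \sum_(n < M) \sum_(k < M | (k <= n)%N) T k (n - k)%N.
  apply: eq_bigr => n _.
  by rewrite (big_ord_widen M (fun k => T k (n - k)%N)).
rewrite (exchange_big_dep xpredT) //= [RHS]big_mkcond /=.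
apply: eq_bigr => k _; case: ltnP => ka; last first.
  by rewrite big1 // => n _; rewrite T0 ?ka.
(* The substitution n = k + j, with j ranging over 0, ..., M - k - 1. *)
rewrite -(big_mkord (fun n => k <= n)%N (fun n => T k (n - k)%N)).
rewrite -(big_mkord (fun j => j < b)%N (T k)).
rewrite (big_cat_nat (n := k)) //=; last exact: ltnW.
rewrite big_nat_cond big1 ?add0r; last first.
  by move=> n /andP[/andP[_ nk]]; rewrite leqNgt nk.
rewrite -{1}[X in \sum_(X <= _ < _ | _) _]add0n big_addn.
rewrite [RHS](big_cat_nat (n := M - k)) ?leq_subr //=.
rewrite [X in _ = _ + X]big_nat_cond [X in _ = _ + X]big1 ?addr0; last first.
  move=> j /andP[/andP[jM _] jb]; move: jM; rewrite leq_subLR leqNgt.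
  by rewrite (leq_trans _ leM) // -addSn leq_add // ltnW.
rewrite big_mkcond [RHS]big_mkcond /=; apply: eq_bigr => j _.
rewrite leq_addl addnK; case: ltnP => // bj.
by rewrite T0 // bj orbT.
Qed.

Section Linear.
Variables (N : nat) (f : {linear V -> V}).
Hypothesis char_large : forall k, (k <= N.*2.+3)%N -> k.+1%:R != 0 :> F.
Hypothesis f_nilp : forall v, iter N f v = 0.

Lemma iter_linear k : linear (iter k f).
Proof. by elim: k => [|k IH] a u v //=; rewrite IH linearP. Qed.

Lemma iter_scale k a v : iter k f (a *: v) = a *: iter k f v.
Proof. by elim: k => [|k IH] //=; rewrite IH linearZ. Qed.

Lemma iter_nilp k v : (N <= k)%N -> iter k f v = 0.
Proof.
by move=> /subnK <-; rewrite iterD f_nilp; elim: (k - N)%N => //= j ->; rewrite linear0.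
Qed.

Lemma divpow_linear k : linear (divpow f k).
Proof.
by move=> a u v; rewrite /divpow iter_linear scalerDr !scalerA mulrC.
Qed.

Lemma texp_linear : linear (texp N f).
Proof.
move=> a u v; rewrite /texp scaler_sumr -big_split /=.
by apply: eq_bigr => k _; rewrite divpow_linear.
Qed.

Lemma divpow_nilp k v : (N <= k)%N -> divpow f k v = 0.
Proof. by move=> Nk; rewrite /divpow iter_nilp ?scaler0. Qed.

Lemma divpow_next k v : (k <= N.*2.+3)%N ->
  f (divpow f k v) = k.+1%:R *: divpow f k.+1 v.
Proof.
move=> lek; rewrite /divpow linearZ scalerA factS natrM invfM mulrA divff ?mul1r //.
exact: char_large.
Qed.

Lemma fact_neq0 k : (k <= N.*2.+4)%N -> k`!%:R != 0 :> F.
Proof.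
elim: k => [|k IH] lek; first by rewrite oner_eq0.
by rewrite factS natrM mulf_neq0 ?char_large // IH // ltnW.
Qed.

(** If ad_f / k sends D (k - 1) to D k, then D k is (ad_f)^k / k! applied to
    D 0, and this is the identity exp(f) B exp(-f) = exp(ad_f) B for B = D 0;
    keeping exp(f) on the right avoids inverses. *)
Lemma texp_intertwine (D : nat -> V -> V) v :
  (forall k, linear (D k)) ->
  (forall k u, f (D k u) = D k (f u) + k.+1%:R *: D k.+1 u) ->
  (forall k u, (N < k)%N -> D k u = 0) ->
  texp N f (D 0 v) = \sum_(k < N.+2) D k (texp N f v).
Proof.
move=> Dlin fD D0.
have DP k : {L : {linear V -> V} | L =1 D k}.
  pose L : {linear V -> V} :=
    HB.pack (D k) (GRing.isLinear.Build F V V _ (D k) (Dlin k)).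
  by exists L.
have Leib n : (n <= N.*2.+4)%N ->
    divpow f n (D 0 v) = \sum_(k < n.+1) D k (divpow f (n - k) v).
  elim: n => [|n IH] len.
    by rewrite big_ord1 /divpow /= fact0 invr1 !scale1r.
  apply: (scalerI (char_large _ : n.+1%:R != 0)); first by [].
  rewrite -divpow_next // IH ?(ltnW len) // linear_sum /=.
  transitivity (\sum_(k < n.+2) (n.+1 - k)%:R *: D k (divpow f (n.+1 - k) v)
              + \sum_(k < n.+2) (k : nat)%:R *: D k (divpow f (n.+1 - k) v)).
    rewrite [X in _ = X + _]big_ord_recr /= subnn scale0r addr0.
    rewrite [X in _ = _ + X]big_ord_recl scale0r add0r -big_split /=.
    apply: eq_bigr => k _; rewrite fD; have [L LE] := DP k.
    have lekn : (k <= n)%N by rewrite -ltnS.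
    rewrite subSn // divpow_next ?(leq_trans (leq_subr _ _)) // ?(ltnW len) //.
    by rewrite /bump add1n subSS -!LE linearZ.
  rewrite -big_split scaler_sumr; apply: eq_bigr => k _ /=.
  by rewrite -scalerDl -natrD subnK // -ltnS.
transitivity (\sum_(n < N.*2.+4) divpow f n (D 0 v)).
  rewrite [RHS](bigID (fun n : 'I__ => (n < N.+1)%N)) /=.
  rewrite [X in _ + X]big1 ?addr0; last first.
    by move=> n; rewrite -leqNgt => /ltnW /divpow_nilp.
  rewrite /texp (big_ord_widen N.*2.+4 (fun n => divpow f n (D 0 v))) //.
  by rewrite ltnS -addnn -addn3 -addnA leq_addr.
transitivity (\sum_(n < N.*2.+4) \sum_(k < n.+1) D k (divpow f (n - k) v)).
  by apply: eq_bigr => n _; apply: Leib; apply: ltnW.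
rewrite (@sum_antidiagonal (fun k j => D k (divpow f j v)) N.+2 N.+1).
- apply: eq_bigr => k _; have [L LE] := DP k.
  by rewrite -LE linear_sum; apply: eq_bigr => j _; rewrite LE.
- move=> k j /orP[Nk|/ltnW Nj]; first by rewrite D0 // ltnW.
  by have [L LE] := DP k; rewrite divpow_nilp // -LE linear0.
- by rewrite addSn addSn addnS addnn.
Qed.

Lemma texp_opp v : texp N f (texp N (fun u => - f u) v) = v.
Proof.
have iterN j u : iter j (fun u => - f u) u = (-1) ^+ j *: iter j f u.
  elim: j => [|j IH] /=; first by rewrite scale1r.
  by rewrite IH linearZ exprS mulN1r scaleNr.
pose T k j := ((k`!%:R)^-1 * ((j`!%:R)^-1 * (-1) ^+ j)) *: iter (k + j) f v.
have -> : texp N f (texp N (fun u => - f u) v)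
    = \sum_(k < N.+1) \sum_(j < N.+1) T k j.
  apply: eq_bigr => k _; rewrite /texp /divpow.
  rewrite -[LHS]/(divpow f k _).
  pose L : {linear V -> V} := HB.pack (divpow f k)
    (GRing.isLinear.Build F V V _ (divpow f k) (divpow_linear k)).
  rewrite -[divpow f k _]/(L _) linear_sum; apply: eq_bigr => j _ /=.
  by rewrite /divpow iterN !iter_scale !scalerA -iterD.
rewrite -(@sum_antidiagonal _ _ _ N.*2.+2); last 2 first.
- by move=> k j /orP[] /ltnW le; rewrite /T iter_nilp ?scaler0 //;
    apply: leq_trans le _; rewrite ?leq_addr ?leq_addl.
- by rewrite addSn addnS addnn.
rewrite big_ord_recl [X in X + _]big_ord1 /T /= big1 ?addr0.
  by rewrite fact0 invr1 !mul1r scale1r.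
move=> n _; rewrite /bump add1n.
(* On the n-th antidiagonal the coefficients add up to (1 - 1)^n / n!. *)
have len : (n.+1 <= N.*2.+4)%N.
  by apply: leq_trans (ltn_ord n) _; rewrite -[N.*2.+4]addn3 leq_addr.
transitivity (((n.+1`!%:R)^-1 * \sum_(k < n.+2)
     ('C(n.+1, k)%:R * (-1) ^+ (n.+1 - k)) : F) *: iter n.+1 f v).
  rewrite mulr_sumr scaler_suml; apply: eq_bigr => k _.
  have lek : (k <= n.+1)%N by rewrite -ltnS.
  rewrite subnKC //; congr (_ *: _); rewrite !mulrA; congr (_ * _).
  have := fact_neq0 len; rewrite -(bin_fact lek) !natrM mulf_eq0 negb_or.
  move=> /andP[bin0 _]; rewrite 2!invfM.
  by rewrite [RHS]mulrAC mulVf // mul1r.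
rewrite (_ : \sum_(k < n.+2) _ = (-1 + 1 : F) ^+ n.+1).
  by rewrite addNr expr0n mulr0 scale0r.
rewrite exprDn; apply: eq_bigr => k _.
by rewrite expr1n mulr1 mulr_natl.
Qed.
End Linear.
End Exponential.


(** * Triangular Lie algebras and their exponential groups *)

Section TriangularLie.
Variables (F : fieldType) (V : vectType F) (I : finType).
Variables (r : I -> nat) (N : nat) (e : I -> V) (c : I -> {scalar V}).
Variables (ad : V -> {linear V -> V}) (delta : {linear V -> V}) (w : I -> F).

(** The indexing r makes all brackets strictly increasing; delta plays the part
    of a regular element of the torus. *)
Hypothesis char_large : forall k, (k <= N.*2.+3)%N -> k.+1%:R != 0 :> F.
Hypothesis r_inj : injective r.
Hypothesis r_lt : forall a, (r a < N)%N.
Hypothesis basisE : forall v, v = \sum_a c a v *: e a.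
Hypothesis coord_e : forall a b, c a (e b) = (a == b)%:R.
Hypothesis ad_anti : forall x y, ad x y = - ad y x.
Hypothesis ad_jacobi : forall x y z,
  ad x (ad y z) = ad (ad x y) z + ad y (ad x z).
Hypothesis ad_tri : forall a b i, (r i <= r a)%N -> c i (ad (e b) (e a)) = 0.
Hypothesis deltaM : forall x y,
  delta (ad x y) = ad (delta x) y + ad x (delta y).
Hypothesis delta_e : forall a, delta (e a) = w a *: e a.
Hypothesis w_neq0 : forall a, w a != 0.
Hypothesis w_inj : injective w.

(** The span of the e a with r a >= k, by coordinates. *)
Definition fil (k : nat) (v : V) : Prop := forall a, (r a < k)%N -> c a v = 0.

Lemma fil_linear k s u v : fil k u -> fil k v -> fil k (s *: u + v).
Proof. by move=> fu fv a ak; rewrite linearP fu // fv // addr0 mulr0. Qed.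

Lemma fil0 k : fil k 0.
Proof. by move=> a _; rewrite linear0. Qed.

Lemma filD k u v : fil k u -> fil k v -> fil k (u + v).
Proof. by rewrite -{2}[u]scale1r; apply: fil_linear. Qed.

Lemma filZ k s u : fil k u -> fil k (s *: u).
Proof. by move=> fu; rewrite -[_ *: _]addr0; apply/fil_linear/fil0. Qed.

Lemma filN k u : fil k u -> fil k (- u).
Proof. by rewrite -scaleN1r; apply: filZ. Qed.

Lemma filB k u v : fil k u -> fil k v -> fil k (u - v).
Proof. by move=> fu /filN; apply: filD. Qed.

Lemma fil_sum k (T : finType) (P : pred T) (G : T -> V) :
  (forall i, P i -> fil k (G i)) -> fil k (\sum_(i | P i) G i).
Proof. by move=> fG; apply: big_ind => //; [apply: fil0 | apply: filD]. Qed.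

Lemma fil_le k m v : (k <= m)%N -> fil m v -> fil k v.
Proof. by move=> km fv a ak; apply/fv/(leq_trans ak). Qed.

Lemma fil_all v : fil 0 v.
Proof. by []. Qed.

Lemma fil_top v : fil N v -> v = 0.
Proof.
by move=> fv; rewrite [v]basisE big1 // => a _; rewrite fv ?scale0r // r_lt.
Qed.

Lemma fil_e a k : (k <= r a)%N -> fil k (e a).
Proof.
move=> ka b bk; rewrite coord_e; case: eqP => // ba.
by move: bk; rewrite ba ltnNge ka.
Qed.

Lemma adDl x y v : ad (x + y) v = ad x v + ad y v.
Proof. by rewrite ad_anti linearD opprD -!ad_anti. Qed.

Lemma adZl s x v : ad (s *: x) v = s *: ad x v.
Proof. by rewrite ad_anti linearZ -scalerN -ad_anti. Qed.

Lemma adNl x v : ad (- x) v = - ad x v.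
Proof. by rewrite -scaleN1r adZl scaleN1r. Qed.

Lemma ad0l v : ad 0 v = 0.
Proof. by have := adZl 0 0 v; rewrite !scale0r. Qed.

Lemma ad_suml (T : finType) (G : T -> V) v :
  ad (\sum_i G i) v = \sum_i ad (G i) v.
Proof.
by apply: (big_morph (fun x => ad x v)) => [x y|]; [apply: adDl|apply: ad0l].
Qed.

Lemma fil_adr k x v : fil k v -> fil k.+1 (ad x v).
Proof.
move=> fv; rewrite [x]basisE ad_suml; apply: fil_sum => b _; rewrite adZl.
apply: filZ; rewrite [v]basisE linear_sum; apply: fil_sum => a _.
rewrite linearZ => i ik; rewrite linearZ /=.
have [ak|ka] := ltnP (r a) k; first by rewrite fv // mul0r.
by rewrite ad_tri ?mulr0 // -ltnS (leq_trans ik).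
Qed.

Lemma fil_adl k x v : fil k x -> fil k.+1 (ad x v).
Proof. by move=> fx; rewrite ad_anti; apply/filN/fil_adr. Qed.

Lemma fil_iter k m x v : fil k v -> fil (k + m) (iter m (ad x) v).
Proof.
move=> fv; elim: m => [|m IH]; first by rewrite addn0.
by rewrite addnS; apply: fil_adr.
Qed.

Lemma ad_nilp x v : iter N (ad x) v = 0.
Proof. by apply: fil_top; apply: (@fil_iter 0); apply: fil_all. Qed.

Lemma coord_delta a v : c a (delta v) = w a * c a v.
Proof.
rewrite {1}[v]basisE linear_sum linear_sum (bigD1 a) //= big1 ?addr0.
  by rewrite !linearZ /= delta_e linearZ /= coord_e eqxx mulr1 mulrC.
move=> b ba; rewrite !linearZ /= delta_e linearZ /= coord_e eq_sym (negPf ba).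
by rewrite !mulr0.
Qed.

Definition Exp (x : V) : V -> V := texp N (ad x).

Lemma ExpE x v : Exp x v = v + \sum_(k < N) divpow (ad x) k.+1 v.
Proof.
by rewrite /Exp /texp big_ord_recl /divpow /= fact0 invr1 scale1r.
Qed.

Lemma Exp_linear x : linear (Exp x).
Proof. exact: texp_linear. Qed.

Lemma ExpKN x v : Exp x (Exp (- x) v) = v.
Proof.
rewrite -{2}[v](@texp_opp _ _ N (ad x) char_large (ad_nilp x)).
congr (texp _ _ _); apply: eq_bigr => k _; congr (_ *: _).
exact/eq_iter/adNl.
Qed.

Lemma Exp_unitriangular k x v : fil k v -> fil k.+1 (Exp x v - v).
Proof.
move=> fv; rewrite ExpE addrC addKr; apply: fil_sum => m _; apply: filZ.
by apply: (@fil_le _ (k + m.+1)); [rewrite addnS ltnS leq_addr|exact: fil_iter].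
Qed.

Lemma Exp_morph x u v : Exp x (ad u v) = ad (Exp x u) (Exp x v).
Proof.
rewrite {1}/Exp; pose D k := ad (divpow (ad x) k u).
have -> : ad u v = D 0 v by rewrite /D /divpow fact0 invr1 scale1r.
have D0 k y : (N <= k)%N -> D k y = 0.
  by move=> Nk; rewrite /D (divpow_nilp (ad_nilp x)) ?ad0l.
rewrite (@texp_intertwine _ _ N (ad x) char_large (ad_nilp x) D).
- rewrite big_ord_recr /= D0 // addr0.
  by rewrite [Exp x u]/texp ad_suml.
- by move=> k s y z; rewrite linearP.
- move=> k y; have [leN|ltN] := leqP k N.*2.+3.
    by rewrite /D ad_jacobi (divpow_next _ char_large) // adZl addrC.
  have leN : (N <= k)%N.
    by apply: leq_trans (ltnW ltN); rewrite -addnn -addn3 -addnA leq_addr.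
  by rewrite !D0 ?linear0 ?scaler0 ?addr0 // (leq_trans leN).
- by move=> k y /ltnW /D0.
Qed.

(** Up to sign, exp(ad x) delta exp(-ad x) - delta is the inner derivation
    by this element. *)
Definition twist (x : V) : V :=
  \sum_(k < N.+1) (k.+1`!%:R)^-1 *: iter k (ad x) (delta x).

Lemma Exp_delta x v : Exp x (delta v) = delta (Exp x v) - ad (twist x) (Exp x v).
Proof.
pose a k := (k.+1`!%:R)^-1 *: iter k (ad x) (delta x).
pose D k y := if k is m.+1 then - ad (a m) y else delta y.
have a0 k : (N <= k)%N -> a k = 0.
  by move=> Nk; rewrite /a (iter_nilp (ad_nilp x)) ?scaler0.
have aS k : (k <= N.*2.+2)%N -> ad x (a k) = k.+2%:R *: a k.+1.
  move=> lek; rewrite /a linearZ scalerA [in RHS]factS natrM invfM mulrA.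
  by rewrite divff ?mul1r // char_large.
rewrite {1}/Exp -[delta v]/(D 0 v).
rewrite (@texp_intertwine _ _ N (ad x) char_large (ad_nilp x) D).
- by rewrite big_ord_recl /= sumrN -ad_suml.
- by case=> [|k] s y z /=; rewrite linearP // opprD scalerN.
- case=> [|k] y /=.
    rewrite scale1r deltaM /a /= invr1 scale1r.
    by rewrite addrAC subrr add0r.
  rewrite linearN ad_jacobi opprD addrC scalerN; congr (_ - _).
  have [lek|ltk] := leqP k N.*2.+2; first by rewrite aS // adZl.
  have lek : (N <= k)%N.
    by apply: leq_trans (ltnW ltk); rewrite -addnn -addn2 -addnA leq_addr.
  by rewrite !a0 ?linear0 ?ad0l ?scaler0 // (leq_trans lek).
- by case=> [|k] y //; rewrite ltnS => lek /=; rewrite a0 // ad0l oppr0.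
Qed.

(** twist is delta up to terms deeper in the filtration. *)
Lemma twist_diff m z z' :
  fil m (z' - z) -> fil m.+1 (twist z' - twist z - delta (z' - z)).
Proof.
move=> fz; rewrite /twist -sumrB big_ord_recl /= invr1 !scale1r.
rewrite -linearB addrC addKr; apply: fil_sum => k _.
rewrite -scalerBr; apply: filZ.
have fd j : fil (m + (0 < j)) (iter j (ad z') (delta z') - iter j (ad z) (delta z)).
  elim: j => [|j IH] /=.
    by rewrite addn0 -linearB => a am; rewrite coord_delta fz ?mulr0.
  rewrite addn1; set s := iter j _ _; set t := iter j _ _.
  have -> : ad z' s - ad z t = ad z' (s - t) + ad (z' - z) t.
    by rewrite linearB adDl adNl addrA subrK.
  apply: filD; last exact: fil_adl.
  by apply: fil_adr; apply: fil_le IH; apply: leq_addr.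
by rewrite -addn1; apply: (fd k.+1).
Qed.

(** Solved one filtration step at a time, the leading term of twist being
    delta, which is invertible. *)
Lemma twist_surj y : exists z, twist z = y.
Proof.
suff [z fz] : exists z, fil N (twist z - y).
  by exists z; apply/eqP; rewrite -subr_eq0; apply/eqP/fil_top.
elim: N => [|m [z fz]]; first by exists 0; apply: fil_all.
case: (pickP (fun i => r i == m)) => [i /eqP ri|no_i]; last first.
  exists z => a; rewrite ltnS leq_eqVlt; case/orP=> [ra|]; last exact: fz.
  by have := no_i a; rewrite ra.
pose s := c i (twist z - y); pose d := - (s / w i) *: e i.
exists (z + d).
have fd : fil m d by apply/filZ/fil_e; rewrite ri.
have := @twist_diff m z (z + d); rewrite [z + d - z]addrC addKr => /(_ fd) ftw a.
move=> am; have := ftw a am; rewrite !linearB /= coord_delta => /eqP.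
rewrite subr_eq0 subr_eq => /eqP ->.
have := am; rewrite ltnS leq_eqVlt; case/orP => [/eqP ra|ra].
  have -> : a = i by apply: r_inj; rewrite ra ri.
  rewrite /d linearZ /= coord_e eqxx mulr1 mulrN mulrC divfK //.
  by rewrite /s linearB /= -addrA addNr.
by rewrite fd // mulr0 add0r -linearB fz.
Qed.

(** The difference of g and h sends e a to a vector in the span of the e b with
    r b > r a on which delta - ad y acts as w a; but on this span delta - ad y is
    triangular with diagonal entries w b different from w a. *)
Lemma unitriangular_intertwiner_unique y (g h : {linear V -> V}) :
  (forall v, g (delta v) = delta (g v) - ad y (g v)) ->
  (forall v, h (delta v) = delta (h v) - ad y (h v)) ->
  (forall k v, fil k v -> fil k.+1 (g v - v)) ->
  (forall k v, fil k v -> fil k.+1 (h v - v)) ->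
  g =1 h.
Proof.
move=> gd hd gu hu v; rewrite [v]basisE !linear_sum; apply: eq_bigr => a _.
rewrite !linearZ; congr (_ *: _); apply/eqP; rewrite -subr_eq0.
set z := g (e a) - h (e a).
have zE : w a *: z = delta z - ad y z.
  rewrite scalerBr -!linearZ -delta_e gd hd /z !linearB /=.
  exact: addrACA.
have fz k : fil ((r a).+1 + k) z.
  elim: k => [|k IH].
    have -> : z = (g (e a) - e a) - (h (e a) - e a) by rewrite opprB addrA subrK.
    by rewrite addn0; apply: filB; [apply: gu|apply: hu]; apply: fil_e.
  rewrite addnS => b bk; have [|kb] := ltnP (r b) ((r a).+1 + k); first exact: IH.
  have := congr1 (c b) zE; rewrite linearZ [RHS]linearB /= coord_delta.
  rewrite (fil_adr y IH) // subr0 => /eqP; rewrite -subr_eq0 -mulrBl mulf_eq0.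
  case/orP=> [|/eqP //]; rewrite subr_eq0 => /eqP /w_inj ab.
  by move: kb; rewrite -ab addSn ltnNge leq_addr.
by apply/eqP/fil_top; apply: fil_le (fz N); apply: leq_addl.
Qed.

(** The product of the exponentials of x and y intertwines delta and
    delta - ad u for u = twist x + exp(ad x) (twist y), and so does the
    exponential of any z with twist z = u. *)
Lemma Exp_comp x y : exists z, forall v, Exp x (Exp y v) = Exp z v.
Proof.
have [z zE] := twist_surj (twist x + Exp x (twist y)).
have lin u : {L : {linear V -> V} | L =1 Exp u}.
  pose L : {linear V -> V} :=
    HB.pack (Exp u) (GRing.isLinear.Build F V V _ (Exp u) (Exp_linear u)).
  by exists L.
have [Lx LxE] := lin x; have [Ly LyE] := lin y; have [Lz LzE] := lin z.
exists z => v; rewrite -LxE -LyE -LzE -[LHS]/((Lx \o Ly) v).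
apply: (@unitriangular_intertwiner_unique (twist z)) => [u|u|k u fu|k u fu] /=.
- rewrite !LxE !LyE Exp_delta -LxE linearB /= !LxE Exp_delta Exp_morph zE.
  by rewrite adDl opprD addrA.
- by rewrite !LzE Exp_delta.
- rewrite -(subrK (Ly u) (Lx (Ly u))) -addrA; apply: filD.
    rewrite LxE; apply: Exp_unitriangular; rewrite -(subrK u (Ly u)).
    apply: (filD _ fu); apply: fil_le (leqnSn k) _.
    by rewrite LyE; apply: Exp_unitriangular.
  by rewrite LyE; apply: Exp_unitriangular.
- by rewrite LzE; apply: Exp_unitriangular.
Qed.

(** * Coadjoint orbits and ranks *)

Definition coad (x : V) (l : 'Hom(V, F^o)) : 'Hom(V, F^o) :=
  linfun (fun y => l (texp N (fun z => - ad x z) y)).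

Lemma coadE x l v : coad x l v = l (Exp (- x) v).
Proof.
have E y : l (texp N (fun z => - ad x z) y) = l (Exp (- x) y).
  congr (l _); apply: eq_bigr => k _; congr (_ *: _).
  by apply: eq_iter => z; rewrite adNl.
have lin : linear (fun y => l (texp N (fun z => - ad x z) y) : F^o).
  by move=> a u u'; rewrite !E Exp_linear linearP.
pose L : {linear V -> F^o} := HB.pack (fun y => l (texp N (fun z => - ad x z) y))
  (GRing.isLinear.Build F V F^o _ _ lin).
by rewrite -E -[LHS]/(linfun L v) lfunE.
Qed.

Lemma coadK x l : coad (- x) (coad x l) = l.
Proof. by apply/lfunP => v; rewrite !coadE ExpKN. Qed.

Lemma coad_comp x y l : exists z, coad x (coad y l) = coad z l.
Proof.
have [z zE] := Exp_comp (- y) (- x); exists (- z).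
by apply/lfunP => v; rewrite !coadE opprK zE.
Qed.

Lemma hom_eq_fil (l m : 'Hom(V, F^o)) k v :
  (forall a, (k <= r a)%N -> l (e a) = m (e a)) -> fil k v -> l v = m v.
Proof.
move=> lm fv; rewrite [v]basisE !linear_sum; apply: eq_bigr => a _.
rewrite !linearZ /=; have [/fv ->|/lm -> //] := ltnP (r a) k.
by rewrite !scale0r.
Qed.

(** The terms of exp(ad x) v beyond the linear one are values of ad x on vectors
    one step deeper than v. *)
Lemma hom_Exp (l : 'Hom(V, F^o)) k x v :
  (forall u, fil k.+1 u -> l (ad x u) = 0) -> fil k v ->
  l (Exp x v) = l v + l (ad x v).
Proof.
move=> l0 fv; rewrite /Exp /texp.
have -> : \sum_(m < N.+1) divpow (ad x) m v
    = v + ad x v + \sum_(m < N) divpow (ad x) m.+2 v.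
  transitivity (\sum_(m < N.+2) divpow (ad x) m v).
    rewrite [RHS]big_ord_recr /= (divpow_nilp (ad_nilp x)) ?addr0 //.
  rewrite 2!big_ord_recl addrA; congr (_ + _ + _).
    by rewrite /divpow /= fact0 invr1 scale1r.
  by rewrite /divpow /= invr1 scale1r.
rewrite !linearD linear_sum big1 ?addr0 // => m _.
rewrite linearZ /= l0 ?scaler0 //.
apply: (@fil_le _ (k + m.+1)); first by rewrite addnS ltnS leq_addr.
exact: fil_iter.
Qed.

(** The derivative of the action of exp(t x) at t = 0, obtained from the action
    of exp(x) alone: for u = (ad x)^(n-1) v, the form l kills exp(x) u - u,
    whose first term is (ad x)^n v and whose other terms have higher powers of
    ad x; hence descending induction on n. *)
Lemma hom_ad_eq0 (l : 'Hom(V, F^o)) k x :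
  (forall v, fil k v -> l (Exp x v) = l v) ->
  forall v, fil k v -> l (ad x v) = 0.
Proof.
move=> lx v fv.
suff iter0 j n : (N <= n.+1 + j)%N -> l (iter n.+1 (ad x) v) = 0.
  by apply: (iter0 N 0); rewrite leq_addl.
elim: j n => [|j IH] n.
  by rewrite addn0 => Nn; rewrite (iter_nilp (ad_nilp x)) // linear0.
move=> Nn; set u := iter n (ad x) v.
have fu : fil k u by exact: (fil_le (leq_addr n k) (fil_iter x fv)).
have := lx u fu; rewrite /Exp /texp.
rewrite -[\sum_(_ < _) _]addr0 -[X in _ + X](divpow_nilp (ad_nilp x) u (leqnSn N)).
rewrite -(big_ord_recr N.+1 (fun m => divpow (ad x) m u)) /=.
rewrite 2!big_ord_recl !linearD linear_sum /=.
rewrite big1 ?addr0 => [|m _]; last first.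
  rewrite /divpow linearZ /= -/(iter m.+2 (ad x) u) /u -iterD.
  have -> : (m.+2 + n = (n.+1 + m).+1)%N by rewrite !addSn addnC.
  by rewrite IH ?scaler0 // addSnnS; apply: leq_trans Nn _; rewrite leq_add2r ltnS leq_addr.
rewrite /divpow /= fact0 invr1 !scale1r => /eqP.
by rewrite -subr_eq0 addrC addKr => /eqP.
Qed.

Definition bracket_matrix (l : 'Hom(V, F^o)) (D : {set I}) : 'M[F]_(#|D|, #|{: I}|) :=
  \matrix_(i, j) l (ad (e (enum_val i)) (e (enum_val j))).

Definition above (a : I) : {set I} := [set b | (r a < r b)%N].
Definition from (a : I) : {set I} := [set b | (r a <= r b)%N].

Definition same_rank (l : 'Hom(V, F^o)) (a : I) : bool :=
  \rank (bracket_matrix l (from a)) == \rank (bracket_matrix l (above a)).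

Lemma above_from l a :
  (bracket_matrix l (above a) <= bracket_matrix l (from a))%MS.
Proof.
apply/row_subP => i; have : enum_val i \in from a.
  by have := enum_valP i; rewrite !inE => /ltnW.
move=> in_from; set j := enum_rank_in in_from (enum_val i).
have -> : row i (bracket_matrix l (above a)) = row j (bracket_matrix l (from a)).
  by apply/rowP => k; rewrite !mxE /j enum_rankK_in.
exact: row_sub.
Qed.

Lemma same_rankE l a :
  same_rank l a = (bracket_matrix l (from a) <= bracket_matrix l (above a))%MS.
Proof. by rewrite /same_rank eq_sym (mxrank_leqif_sup (above_from l a)). Qed.

Lemma bracket_matrixM l D m (X : 'M_(_, m)) i j :
  (bracket_matrix l D *m X) i j
    = l (ad (e (enum_val i)) (\sum_k X k j *: e (enum_val k))).
Proof.
rewrite mxE !linear_sum; apply: eq_bigr => k _.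
by rewrite mxE !linearZ /= mulrC.
Qed.

(** The rank equality says that e a does not enlarge the functionals
    l([e b, y]), r b > r a. *)
Lemma same_rank_ad l a y : same_rank l a ->
  (forall b, (r a < r b)%N -> l (ad (e b) y) = 0) -> l (ad (e a) y) = 0.
Proof.
rewrite same_rankE => /submxP[X AE] ly.
pose Y : 'cV[F]_#|{: I}| := \col_j c (enum_val j) y.
have YE : \sum_k Y k 0 *: e (enum_val k) = y.
  rewrite [RHS]basisE (reindex _ (onW_bij _ (@enum_val_bij I))) /=.
  by apply: eq_bigr => k _; rewrite mxE.
have in_from : a \in from a by rewrite inE.
have -> : l (ad (e a) y)
    = (bracket_matrix l (from a) *m Y) (enum_rank_in in_from a) 0.
  by rewrite bracket_matrixM YE enum_rankK_in.
rewrite AE -mulmxA (_ : bracket_matrix l (above a) *m Y = 0) ?mulmx0 ?mxE //.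
apply/matrixP => i j; rewrite ord1 bracket_matrixM YE mxE ly //.
by have := enum_valP i; rewrite inE.
Qed.

(** The columns of the cokernel of the rows above a are the candidates for y. *)
Lemma not_same_rank_ad l a : ~~ same_rank l a ->
  exists2 y, forall b, (r a < r b)%N -> l (ad (e b) y) = 0
           & l (ad (e a) y) != 0.
Proof.
rewrite same_rankE submxE; set K := cokermx _ => /eqP AK.
have [[i j] /= AKij|AK0] :=
    pickP (fun ij => (bracket_matrix l (from a) *m K) ij.1 ij.2 != 0); last first.
  case: AK; apply/matrixP => i j; rewrite [RHS]mxE.
  by apply/eqP; have := AK0 (i, j) => /negbFE.
pose y := \sum_k K k j *: e (enum_val k).
have y0 b : (r a < r b)%N -> l (ad (e b) y) = 0.
  move=> ab; have in_above : b \in above a by rewrite inE.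
  have := congr1 (fun M : 'M__ => M (enum_rank_in in_above b) j)
                 (mulmx_coker (bracket_matrix l (above a))).
  by rewrite bracket_matrixM enum_rankK_in // mxE.
exists y => //; rewrite bracket_matrixM -/y in AKij.
have := enum_valP i; rewrite inE leq_eqVlt => /orP[/eqP /r_inj ->//|/y0 l0].
by rewrite l0 eqxx in AKij.
Qed.

Definition normal_form (l : 'Hom(V, F^o)) : Prop :=
  forall a, l (e a) != 0 -> same_rank l a.

(** Both ranks at a only involve the values of the form above a. *)
Lemma same_rank_local (l m : 'Hom(V, F^o)) a :
  (forall b, (r a < r b)%N -> l (e b) = m (e b)) ->
  same_rank l a = same_rank m a.
Proof.
move=> lm; rewrite /same_rank.
have E (D : {set I}) : D \subset from a -> bracket_matrix l D = bracket_matrix m D.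
  move=> /subsetP Da; apply/matrixP => i j; rewrite !mxE.
  apply: (@hom_eq_fil _ _ (r a).+1) => //.
  apply/fil_adl/fil_e.
  by have := Da _ (enum_valP i); rewrite inE.
rewrite !E //; apply/subsetP => b; rewrite !inE; exact: ltnW.
Qed.

(** If the ranks at a differ, some y moves the value at e a along a line while
    fixing the values above a. *)
Lemma clear_coordinate (l : 'Hom(V, F^o)) a : ~~ same_rank l a ->
  exists2 y, coad y l (e a) = 0 &
    forall b, (r a < r b)%N -> coad y l (e b) = l (e b).
Proof.
move=> /not_same_rank_ad[y ly lay].
pose t := - l (e a) / l (ad (e a) y).
have l0 s u : fil (r a).+1 u -> l (ad (- (s *: y)) u) = 0.
  move=> fu; rewrite adNl adZl ad_anti scalerN opprK linearZ /=.
  suff -> : l (ad u y) = 0 by rewrite scaler0.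
  rewrite [u]basisE ad_suml linear_sum big1 // => b _.
  rewrite adZl linearZ /=; have [/fu ->|/ly ->] := ltnP (r b) (r a).+1.
    by rewrite scale0r.
  by rewrite scaler0.
exists (t *: y) => [|b ab]; rewrite coadE.
  rewrite (@hom_Exp _ (r a)); last exact: fil_e; last exact: l0.
  rewrite adNl adZl ad_anti scalerN opprK linearZ /=.
  by rewrite -[_ *: _]/(_ * _) divfK // subrr.
rewrite (@hom_Exp _ (r a).+1); last exact: fil_e.
  by rewrite l0 ?addr0 //; apply: fil_e.
by move=> u fu; apply: l0; apply: fil_le fu.
Qed.

(** Once the basis vectors of index at least N - j are settled, treating the one
    of index N - j - 1 does not disturb them. *)
Lemma normal_form_exists l0 : exists x, normal_form (coad x l0).
Proof.
suff [x xP] : exists x, forall a, (N <= r a + N)%N ->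
    coad x l0 (e a) != 0 -> same_rank (coad x l0) a.
  by exists x => a; apply: xP; apply: leq_addl.
elim: {2}N => [|j [x xP]].
  by exists 0 => a; rewrite addn0 leqNgt r_lt.
case: (pickP (fun a => (N == r a + j.+1)%N
    && (coad x l0 (e a) != 0) && ~~ same_rank (coad x l0) a)); last first.
  move=> ok; exists x => a; rewrite leq_eqVlt addnS ltnS.
  case/orP=> [aj la|]; last exact: xP.
  by have := ok a; rewrite addnS aj la => /negbFE.
move=> a /andP[/andP[/eqP aj _]] /clear_coordinate[y ya yb].
have [z zE] := coad_comp y x l0; exists z => b; rewrite -zE => bj.
have [ba|] := leqP (r b) (r a).
  have -> : b = a.
    apply: r_inj; apply/eqP; rewrite eqn_leq ba.
    by move: bj; rewrite {1}aj leq_add2r.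
  by rewrite ya eqxx.
move=> ab; rewrite yb // => lb.
rewrite (@same_rank_local _ (coad x l0)); last first.
  by move=> b' /(ltn_trans ab) /yb.
by apply: xP lb; rewrite aj addnS -addSn leq_add2r.
Qed.

(** Where the ranks agree, an exponential fixing the values above a also fixes
    the value at a. *)
Lemma normal_form_unique x l :
  normal_form l -> normal_form (coad x l) -> coad x l = l.
Proof.
move=> nl nm.
suff eqN j a : (N <= r a + j)%N -> coad x l (e a) = l (e a).
  apply/lfunP => v; apply: (@hom_eq_fil _ _ 0); last exact: fil_all.
  by move=> a _; apply: (eqN N); apply: leq_addl.
elim: j a => [|j IH] a; first by rewrite addn0 leqNgt r_lt.
move=> aj; have above_eq b : (r a < r b)%N -> coad x l (e b) = l (e b).
  move=> ab; apply: IH; apply: leq_trans aj _.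
  by rewrite addnS -addSn leq_add2r.
suff fixed : same_rank l a -> coad x l (e a) = l (e a).
  have [l0|la] := eqVneq (l (e a)) 0; last exact/fixed/nl.
  have [->//|/nm ra] := eqVneq (coad x l (e a)) 0.
  apply: fixed; move: ra.
  by rewrite (same_rank_local above_eq).
move=> rk; have adx0 : forall v, fil (r a).+1 v -> l (ad (- x) v) = 0.
  apply: hom_ad_eq0 => v fv; rewrite -coadE.
  exact: hom_eq_fil above_eq fv.
rewrite coadE (hom_Exp adx0); last exact: fil_e.
rewrite ad_anti linearN /= (same_rank_ad rk) ?oppr0 ?addr0 // => b ab.
by rewrite ad_anti linearN /= adx0 ?oppr0 //; apply: fil_e.
Qed.

Theorem orbit_normal_form l0 :
  exists! l, normal_form l /\ exists x, l = coad x l0.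
Proof.
have [x nx] := normal_form_exists l0.
exists (coad x l0); split; first by split=> //; exists x.
move=> m [nm [y mE]]; subst m.
have [z zE] := coad_comp y (- x) (coad x l0); rewrite coadK in zE.
by rewrite zE; apply/esym/normal_form_unique; rewrite -?zE.
Qed.
End TriangularLie.


(** * Positive roots *)

Lemma epsE k (j : 'I_4) : (0 < k <= 4)%N -> eps k 0 j = (j.+1 == k)%:R.
Proof.
case: k => // k k4; rewrite mxE /= eqSS; congr (nat_of_bool _)%:R.
by rewrite -val_eqE /= inordK.
Qed.

Lemma simple_root_free (a : 'rV[rat]_4) :
  a *m (\matrix_(i < 4) simple_root i) = 0 -> a = 0.
Proof.
move=> /rowP s0.
have := (s0 (@Ordinal 4 0 isT), s0 (@Ordinal 4 1 isT), s0 (@Ordinal 4 2 isT),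
         s0 (@Ordinal 4 3 isT)).
rewrite !mxE !big_ord_recl !big_ord0 !mxE /simple_root /=.
rewrite -!val_eqE /= !inordK //=.
set a0 := a 0 ord0; set a1 := a 0 (lift ord0 ord0).
set a2 := a 0 (lift ord0 (lift ord0 ord0)).
set a3 := a 0 (lift ord0 (lift ord0 (lift ord0 ord0))) => -[[[]]] e0 e1 e2 e3.
have [a00 a10 a20 a30] : [/\ a0 = 0, a1 = 0, a2 = 0 & a3 = 0] by split; lra.
apply/rowP => i; rewrite mxE.
case: (unliftP ord0 i) => [{}i|] -> //.
case: (unliftP ord0 i) => [{}i|] -> //.
case: (unliftP ord0 i) => [{}i|] -> //.
by rewrite [i]ord1.
Qed.

(** Each family of roots is listed with a coordinate that is visibly nonzero. *)
Lemma F4_roots_neq0 : 0 \notin F4_roots.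
Proof.
have sN0 s : s \in signs -> s != 0 by rewrite !inE => /orP[]/eqP->.
have entry (v : 'rV[rat]_4) i : v 0 i != 0 -> 0 <> v.
  by move=> vi v0; rewrite -v0 mxE eqxx in vi.
rewrite /F4_roots mem_cat negb_or; apply/andP; split;
  last rewrite mem_cat negb_or; last (apply/andP; split).
- apply/allpairsPdep => -[s [i [/sN0 s0]]]; rewrite mem_iota => i4.
  have k4 : (i.-1 < 4)%N by case: i i4.
  apply: (entry _ (Ordinal k4)); rewrite mxE epsE //=.
  by rewrite prednK ?eqxx ?mulr1 //; case/andP: i4.
- apply/flattenP => -[_ /allpairsPdep[i [j [i4 j4 ->]]]].
  case/allpairsPdep => s [t [/sN0 s0 _]].
  move: i4 j4; rewrite !mem_iota => i4 j4.
  have k4 : (i.-1 < 4)%N by case: i i4 {j4}.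
  apply: (entry _ (Ordinal k4)).
  rewrite [_ 0 _]mxE [X in X + _]mxE [X in _ + X]mxE.
  rewrite !epsE //=; last by lia.
  rewrite prednK; last by lia.
  rewrite eqxx [i == j]ltn_eqF ?mulr0 ?addr0 ?mulr1 //; lia.
- apply/allpairsPdep => -[u [v []]].
  case/allpairsPdep => s [t [/sN0 s0 _ ->]] /allpairsPdep[s' [t' [_ _ ->]]].
  apply: (entry _ ord0).
  rewrite [_ 0 _]mxE [X in _ * X]mxE [X in X + _]mxE [X in _ + X]mxE.
  rewrite [X in X + _ + _]mxE [X in _ + X + _]mxE [X in _ + (X + _)]mxE [X in _ + (_ + X)]mxE.
  rewrite !epsE //= !mulr0 mulr1 !addr0 mulf_neq0 //.
Qed.

Lemma coordsD u v : coords (u + v) = coords u + coords v.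
Proof. exact: mulmxDl. Qed.

Lemma coords_inj : injective coords.
Proof.
have free : row_free (\matrix_(i < 4) simple_root i).
  rewrite -kermx_eq0; apply/eqP/row_matrixP => i; rewrite row0.
  by apply: simple_root_free; rewrite -row_mul mulmx_ker row0.
have unit : \matrix_(i < 4) simple_root i \in unitmx by rewrite -row_free_unit.
by apply: can_inj (mulmxKV unit).
Qed.

Lemma coords0 : coords 0 = 0.
Proof. exact: mul0mx. Qed.

Lemma vec_inj : injective vec.
Proof. by move=> a b /val_inj /val_inj. Qed.

Lemma vec_root (a : pos_root) : vec a \in F4_roots.
Proof. exact: ssvalP (val a). Qed.

Lemma coords_ge0 (a : pos_root) i : 0 <= coords (vec a) 0 i.
Proof. by have /forallP := valP a; apply. Qed.

Lemma pos_root_sum_neq0 (a b : pos_root) : vec a + vec b != 0.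
Proof.
apply/eqP => ab0; have : vec a = 0.
  apply: coords_inj; rewrite coords0; apply/rowP => i; rewrite [RHS]mxE.
  have := congr1 (fun v => coords v 0 i) ab0; rewrite coordsD coords0.
  rewrite [LHS]mxE [RHS]mxE.
  move/eqP; rewrite paddr_eq0 ?coords_ge0 // => /andP[/eqP-> _] //.
by move=> a0; have := vec_root a; rewrite a0 (negPf F4_roots_neq0).
Qed.

Lemma pos_root_sum (a b : pos_root) : vec a + vec b \in F4_roots ->
  {c : pos_root | vec a + vec b = vec c}.
Proof.
move=> ab; have pos : positive (ssval (SeqSub ab)).
  by apply/forallP => i; rewrite coordsD mxE addr_ge0 ?coords_ge0.
by exists (exist _ (SeqSub ab) pos).
Qed.

Definition lex_gt_at (i : 'I_4) (u v : 'rV[rat]_4) : Prop :=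
  v 0 i < u 0 i /\ forall j : 'I_4, (j < i)%N -> u 0 j = v 0 j.

Lemma root_gtP (a b : pos_root) :
  reflect (exists i, lex_gt_at i (coords (vec a)) (coords (vec b)))
          (root_gt a b).
Proof.
apply: (iffP existsP) => -[i].
  move=> /andP[lt /forallP eq]; exists i; split=> // j ji.
  by apply/eqP/(implyP (eq j)).
move=> [lt eq]; exists i; apply/andP; split=> //.
by apply/forallP => j; apply/implyP => /eq ->.
Qed.

Lemma first_difference (u v : 'rV[rat]_4) : u != v ->
  exists i, u 0 i != v 0 i /\ forall j : 'I_4, (j < i)%N -> u 0 j = v 0 j.
Proof.
move=> uv; have /existsP[i0 uvi0] : [exists i, u 0 i != v 0 i].
  apply: contraNT uv => /existsPn uv; apply/eqP/rowP => i.
  by apply/eqP/negPn/uv.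
have [i uvi imin] := @arg_minnP _ i0 (fun i => u 0 i != v 0 i) val uvi0.
exists i; split=> // j ji; apply/eqP; apply: contraTT ji => uvj.
by rewrite -leqNgt imin.
Qed.

Lemma root_gt_trans : transitive root_gt.
Proof.
move=> b a c /root_gtP[i [lti eqi]] /root_gtP[j [ltj eqj]].
apply/root_gtP; case: (ltngtP i j) => ij.
- exists i; split=> [|k ki]; first by rewrite -eqj.
  by rewrite eqi // eqj // (ltn_trans ki).
- exists j; split=> [|k kj]; first by rewrite eqi.
  by rewrite eqi ?eqj // (ltn_trans kj).
- move/val_inj: ij => ij; subst j; exists i.
  by split=> [|k ki]; [apply: lt_trans lti | rewrite eqi ?eqj].
Qed.

Lemma root_gt_irr a : root_gt a a = false.
Proof. by apply/root_gtP => -[i []]; rewrite ltxx. Qed.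

Lemma root_gt_total a b : a != b -> root_gt a b || root_gt b a.
Proof.
rewrite -(inj_eq vec_inj) -(inj_eq coords_inj) => /first_difference[i []].
rewrite neq_lt => /orP[] lt eq; apply/orP; [right|left]; apply/root_gtP.
  by exists i; split=> // j /eq ->.
by exists i; split.
Qed.

(** The difference of vec c and vec a is the root vec b, whose coordinates are
    nonnegative and not all zero. *)
Lemma root_gt_sum (a b c : pos_root) : vec a + vec b = vec c -> root_gt c a.
Proof.
move=> abc; have cE i : coords (vec c) 0 i = coords (vec a) 0 i + coords (vec b) 0 i.
  by rewrite -abc coordsD mxE.
have [|i [cai eqi]] := @first_difference (coords (vec c)) (coords (vec a)).
  rewrite (inj_eq coords_inj) -abc -subr_eq0 addrC addKr.
  by apply: contraTneq (vec_root b) => ->; exact: F4_roots_neq0.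
apply/root_gtP; exists i; split=> //.
by rewrite lt_def cai cE lerDl coords_ge0.
Qed.

Definition rank_of (a : pos_root) : nat := #|[set b | root_gt a b]|.

Lemma rank_of_mono a b : root_gt a b -> (rank_of b < rank_of a)%N.
Proof.
move=> ab; apply: proper_card; apply/properP; split.
  by apply/subsetP => c; rewrite !inE; apply: root_gt_trans.
by exists b; rewrite !inE // root_gt_irr.
Qed.

Lemma root_gt_rank a b : root_gt a b = (rank_of b < rank_of a)%N.
Proof.
apply/idP/idP => [|ba]; first exact: rank_of_mono.
have [ab|/root_gt_total/orP[//|/rank_of_mono]] := eqVneq a b.
  by rewrite ab ltnn in ba.
by rewrite ltnNge ltnW.
Qed.

Lemma rank_of_inj : injective rank_of.
Proof.
move=> a b ab; apply/eqP; apply: contraT => /root_gt_total.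
by rewrite !root_gt_rank ab ltnn.
Qed.

Lemma root_ge_rank a b : root_ge a b = (rank_of b <= rank_of a)%N.
Proof. by rewrite /root_ge root_gt_rank [RHS]leq_eqVlt (inj_eq rank_of_inj) eq_sym. Qed.

Lemma rank_of_lt a : (rank_of a < #|{: pos_root}|)%N.
Proof.
rewrite -cardsT; apply: proper_card; rewrite properT; apply/eqP => aT.
by have := in_setT a; rewrite -aT inE root_gt_irr.
Qed.

(** The coordinates of v are coefficients of a polynomial, which is evaluated
    at a natural number outside the finitely many roots of all of them. *)
Lemma separating_functional n (s : seq 'rV[rat]_n) : 0 \notin s ->
  exists t : nat, forall v, v \in s -> (rVpoly v).[t%:R] != 0.
Proof.
move=> s0; pose p := \prod_(v <- s) rVpoly v.
have p0 : p != 0.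
  rewrite prodf_seq_neq0; apply/allP => v vs /=; apply: contraNneq s0 => v0.
  by have <- : v = 0 by rewrite -[v]rVpolyK v0 linear0.
have [t pt] : exists t : nat, ~~ root p t%:R.
  have /allPn[x] : ~~ all (root p) [seq i%:R | i <- iota 0 (size p)].
    apply/negP => /(max_poly_roots p0).
    rewrite size_map size_iota ltnn => /(_ _)/notF; apply.
    rewrite map_inj_uniq ?iota_uniq //.
    by move=> i j /eqP; rewrite eqr_nat => /eqP.
  by case/mapP => t _ -> pt; exists t.
exists t => v vs; move: pt; rewrite rootE horner_prod prodf_seq_neq0.
by move/allP/(_ v vs).
Qed.

(** An additive weight on the positive roots, faithful enough to tell them
    apart: heights would not do, as several roots share a height. *)
Lemma integral_weight : exists W : pos_root -> int,
  [/\ forall a, W a != 0, injective W &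
      forall a b c, vec a + vec b = vec c -> W c = W a + W b].
Proof.
pose s := [seq vec a | a : pos_root]
  ++ [seq vec ab.1 - vec ab.2 | ab <- enum {: pos_root * pos_root} & ab.1 != ab.2].
have [|t tP] := @separating_functional 4 s.
  rewrite mem_cat negb_or; apply/andP; split.
    apply/mapP => -[a _ a0]; have := vec_root a.
    by rewrite -a0 (negPf F4_roots_neq0).
  apply/mapP => -[[a b]]; rewrite mem_filter => /andP[/= ab _] /esym/eqP.
  by rewrite subr_eq0 (inj_eq vec_inj) (negPf ab).
pose phi (v : 'rV[rat]_4) := (rVpoly v).[t%:R].
have [D D0 [W WE]] : exists2 D : int, D != 0 &
    exists W : pos_root -> int, forall a, (W a)%:~R = phi (vec a) * D%:~R.
  exists (\prod_(a : pos_root) denq (phi (vec a))).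
    by apply/prodf_neq0 => a _; apply: denq_neq0.
  exists (fun a => numq (phi (vec a))
    * \prod_(b : pos_root | b != a) denq (phi (vec b))) => a.
  by rewrite [in RHS](bigD1 a) //= !intrM numqE mulrA.
have phiB u v : phi (u - v) = phi u - phi v by rewrite /phi linearB hornerD hornerN.
have DQ0 : D%:~R != 0 :> rat by rewrite intr_eq0.
exists W; split.
- move=> a; rewrite -(intr_eq0 rat) WE mulf_neq0 //; apply: tP.
  by rewrite mem_cat; apply/orP; left; apply/mapP; exists a; rewrite ?mem_enum.
- move=> a b Wab; apply/eqP; apply: contraT => ab.
  have /tP : vec a - vec b \in s.
    rewrite mem_cat; apply/orP; right; apply/mapP; exists (a, b); last by [].
    by rewrite mem_filter mem_enum /= ab.
  rewrite -/(phi _) phiB subr_eq0 => /eqP[]; apply: (mulIf DQ0).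
  by rewrite -(WE a) -(WE b) Wab.
- move=> a b c abc; apply: (@intr_inj rat); rewrite intrD !WE -mulrDl -abc.
  by congr (_ * _); rewrite /phi linearD hornerD.
Qed.


(** * The nilradical in the basis of root vectors *)

Section Nilradical.
Variables (F : fieldType) (g : lieAlgebra F) (C : chevalley_basis g).

HB.instance Definition _ (x : g) :=
  GRing.isLinear.Build F g g _ (bracket x) (bracket_linearr x).

Lemma bracket_anti (x y : g) : bracket x y = - bracket y x.
Proof.
have addl u v z : bracket (u + v) z = bracket u z + bracket v z :> g.
  by have := bracket_linearl z 1 u v; rewrite !scale1r.
apply/eqP; rewrite -addr_eq0; apply/eqP.
by have := bracketxx (x + y); rewrite linearD /= !addl !bracketxx add0r addr0 addrC.
Qed.

Lemma bracketZl s (x y : g) : bracket (s *: x) y = s *: bracket x y.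
Proof. by rewrite bracket_anti linearZ -scalerN -bracket_anti. Qed.

Lemma bracket_leibniz (x y z : g) :
  bracket x (bracket y z) = bracket (bracket x y) z + bracket y (bracket x z).
Proof.
apply/eqP; rewrite -subr_eq0 opprD addrA (bracket_anti (bracket x y)) opprK.
rewrite -linearN -bracket_anti; apply/eqP; rewrite -[RHS](bracket_jacobi x y z).
by rewrite addrAC.
Qed.

Definition pos_vectors : seq g := codom (fun a : pos_root => chev_x C (val a)).

(** A subfamily of the Chevalley basis. *)
Lemma pos_vectors_free : free pos_vectors.
Proof.
have fr := basis_free (chev_basis C).
have /injectiveP xinj : uniq (codom (chev_x C)).
  by apply: free_uniq; apply: catr_free fr.
have uniq_pos : uniq pos_vectors.
  by apply/injectiveP => a b /xinj /val_inj.
have sub : {subset pos_vectors <= codom (chev_h C) ++ codom (chev_x C)}.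
  by move=> v /codomP[a ->]; rewrite mem_cat codom_f orbT.
rewrite (perm_free (Y := [seq v <- codom (chev_h C) ++ codom (chev_x C) | v \in pos_vectors])).
  exact: filter_free.
apply: uniq_perm => //; first by rewrite filter_uniq // free_uniq.
by move=> v; rewrite mem_filter; case: (boolP (v \in pos_vectors)) => // /sub ->.
Qed.

Lemma dim_nilradical : \dim (nilradical C) = #|{: pos_root}|.
Proof.
have := pos_vectors_free; rewrite /free => /eqP.
by rewrite size_codom => <-.
Qed.

Lemma pos_bracket (a b : pos_root) :
  bracket (chev_x C (val a)) (chev_x C (val b)) = 0 \/
  exists (c : pos_root) (s : F), vec a + vec b = vec c /\
    bracket (chev_x C (val a)) (chev_x C (val b)) = s *: chev_x C (val c).
Proof.
case: (boolP (vec a + vec b \in F4_roots)) => [/pos_root_sum[c abc]|ab].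
  by right; have [s sE] := chev_add C abc; exists c; eexists; split; [|exact: sE].
by left; apply: chev_0 => //; apply: pos_root_sum_neq0.
Qed.

Definition pos_coord (a : pos_root) (v : g) : F :=
  coord (codom_tuple (fun a : pos_root => chev_x C (val a))) (enum_rank a) v.

Lemma pos_coord_linear a : scalar (pos_coord a).
Proof. exact: linearP. Qed.

HB.instance Definition _ a :=
  GRing.isLinear.Build F g F _ (pos_coord a) (pos_coord_linear a).

Lemma nth_pos_vectors (i : 'I_#|{: pos_root}|) :
  (codom_tuple (fun a : pos_root => chev_x C (val a)))`_i = chev_x C (val (enum_val i)).
Proof. exact: nth_codom. Qed.

Lemma pos_coord_x a b : pos_coord a (chev_x C (val b)) = (a == b)%:R.
Proof.
rewrite /pos_coord -{1}[b]enum_rankK -nth_pos_vectors coord_free.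
  by rewrite (inj_eq enum_rank_inj) eq_sym.
exact: pos_vectors_free.
Qed.

Lemma pos_coordE v : v \in nilradical C ->
  v = \sum_a pos_coord a v *: chev_x C (val a).
Proof.
move=> vn; rewrite {1}(coord_span (X := codom_tuple (fun a => chev_x C (val a))) vn).
rewrite [RHS](reindex _ (onW_bij _ (@enum_val_bij pos_root))) /=.
by apply: eq_bigr => i _; rewrite nth_pos_vectors /pos_coord enum_valK.
Qed.

Lemma chev_x_nilradical (a : pos_root) : chev_x C (val a) \in nilradical C.
Proof. exact/memv_span/codom_f. Qed.

Lemma nilradical_bracket (x y : g) :
  x \in nilradical C -> y \in nilradical C -> bracket x y \in nilradical C.
Proof.
have half z : (forall a : pos_root, bracket z (chev_x C (val a)) \in nilradical C) ->
    forall u, u \in nilradical C -> bracket z u \in nilradical C.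
  move=> za u /pos_coordE ->; rewrite linear_sum; apply: memv_suml => a _.
  by rewrite linearZ; apply/memvZ/za.
move=> xn; apply: (half x) => a; rewrite bracket_anti rpredN; move: xn.
apply: half => b; have [->|[c [s [_ ->]]]] := pos_bracket a b; first exact: mem0v.
by rewrite memvZ // chev_x_nilradical.
Qed.

Lemma vsval_nbracket (x y : subvs_of (nilradical C)) :
  vsval (nbracket x y) = bracket (vsval x) (vsval y).
Proof. by rewrite vsprojK // nilradical_bracket ?subvsP. Qed.

Lemma nbracket_linear (x : subvs_of (nilradical C)) : linear (nbracket x).
Proof.
by move=> s u v; apply: subvs_inj; rewrite vsval_nbracket !linearP /= !vsval_nbracket.
Qed.

Definition nad (x : subvs_of (nilradical C)) :
    {linear subvs_of (nilradical C) -> subvs_of (nilradical C)} :=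
  HB.pack (nbracket x) (GRing.isLinear.Build F _ _ _ (nbracket x) (nbracket_linear x)).

Lemma nad_anti x y : nad x y = - nad y x.
Proof.
by apply: subvs_inj; rewrite linearN /= !vsval_nbracket bracket_anti.
Qed.

Lemma nad_jacobi x y z : nad x (nad y z) = nad (nad x y) z + nad y (nad x z).
Proof.
by apply: subvs_inj; rewrite linearD /= !vsval_nbracket bracket_leibniz.
Qed.

Section RootVectors.
Variable e : pos_root -> subvs_of (nilradical C).
Hypothesis e_root : root_vectors e.

Let k (a : pos_root) : F := pos_coord a (vsval (e a)).

Lemma root_vectorE a : vsval (e a) = k a *: chev_x C (val a).
Proof.
have [_ /vlineP[s es]] := e_root a.
by rewrite /k es linearZ /= pos_coord_x eqxx mulr1.
Qed.

Lemma root_vector_coef_neq0 a : k a != 0.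
Proof.
have [e0 _] := e_root a; apply: contraNneq e0 => k0.
by apply/eqP/subvs_inj; rewrite root_vectorE k0 scale0r linear0.
Qed.

Definition root_coord (a : pos_root) (v : subvs_of (nilradical C)) : F :=
  (k a)^-1 * pos_coord a (vsval v).

Lemma root_coord_linear a : scalar (root_coord a).
Proof. by move=> s u v; rewrite /root_coord !linearP /= mulrDr mulrCA. Qed.

Definition root_coordL a : {scalar subvs_of (nilradical C)} :=
  HB.pack (root_coord a)
    (GRing.isLinear.Build F _ _ _ (root_coord a) (root_coord_linear a)).

Lemma root_coord_e a b : root_coord a (e b) = (a == b)%:R.
Proof.
rewrite /root_coord root_vectorE linearZ /= pos_coord_x.
case: eqP => [->|_]; last by rewrite !mulr0.
by rewrite mulr1 mulVf // root_vector_coef_neq0.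
Qed.

Lemma root_coordE v : v = \sum_a root_coord a v *: e a.
Proof.
apply: subvs_inj; rewrite linear_sum [LHS]pos_coordE ?subvsP //.
apply: eq_bigr => a _; rewrite linearZ /= root_vectorE scalerA.
by rewrite /root_coord mulrAC mulVf ?mul1r // root_vector_coef_neq0.
Qed.

Lemma nad_e a b : nad (e a) (e b) = 0 \/
  exists c s, vec a + vec b = vec c /\ nad (e a) (e b) = s *: e c.
Proof.
have E : vsval (nad (e a) (e b))
    = (k a * k b) *: bracket (chev_x C (val a)) (chev_x C (val b)).
  by rewrite vsval_nbracket !root_vectorE bracketZl linearZ /= scalerA.
have [x0|[c [s [abc xE]]]] := pos_bracket a b.
  by left; apply: subvs_inj; rewrite E x0 scaler0 linear0.
right; exists c, (k a * k b * s / k c); split=> //; apply: subvs_inj.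
rewrite E xE linearZ /= root_vectorE !scalerA divfK ?root_vector_coef_neq0 //.
by rewrite mulrC.
Qed.

Lemma nad_tri a b i : (rank_of i <= rank_of a)%N ->
  root_coord i (nad (e b) (e a)) = 0.
Proof.
move=> ia; have [->|[c [s [bac ->]]]] := nad_e b a; first exact: (linear0 (root_coordL i)).
rewrite [LHS](linearZ_LR (root_coordL i)) /= root_coord_e.
have := @root_gt_sum a b c; rewrite addrC => /(_ bac); rewrite root_gt_rank.
case: eqP => [<-|_ _]; last by rewrite mulr0.
by rewrite ltnNge ia.
Qed.

Variable W : pos_root -> int.
Hypothesis WD : forall a b c, vec a + vec b = vec c -> W c = W a + W b.

Definition grading (v : subvs_of (nilradical C)) : subvs_of (nilradical C) :=
  \sum_a ((W a)%:~R * root_coord a v) *: e a.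

Lemma grading_linear : linear grading.
Proof.
move=> s u v; rewrite scaler_sumr -big_split; apply: eq_bigr => a _ /=.
by rewrite root_coord_linear mulrDr mulrCA scalerDl scalerA.
Qed.

Definition gradingL : {linear subvs_of (nilradical C) -> subvs_of (nilradical C)} :=
  HB.pack grading (GRing.isLinear.Build F _ _ _ grading grading_linear).

Lemma grading_e a : grading (e a) = (W a)%:~R *: e a.
Proof.
rewrite /grading (bigD1 a) //= big1 ?addr0 => [|b ba].
  by rewrite root_coord_e eqxx mulr1.
by rewrite root_coord_e (negPf ba) mulr0 scale0r.
Qed.

Lemma grading_derivation x y :
  gradingL (nad x y) = nad (gradingL x) y + nad x (gradingL y).
Proof.
have ext (h h' : {linear subvs_of (nilradical C) -> subvs_of (nilradical C)}) :
    (forall a, h (e a) = h' (e a)) -> h =1 h'.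
  move=> hh' v; rewrite [v]root_coordE !linear_sum.
  by apply: eq_bigr => a _; rewrite !linearZ /= hh'.
(* Linearity in the second argument and antisymmetry reduce the identity to
   pairs of root vectors. *)
pose h z := gradingL \o nad z; pose h' z := nad (gradingL z) \+ (nad z \o gradingL).
have half z : (forall a, h z (e a) = h' z (e a)) -> h z =1 h' z by apply: ext.
suff h_anti z u : h z u = h' z u -> h u z = h' u z.
  apply: (half x) => a; apply: h_anti; apply: half => b.
  rewrite -[h _ _]/(gradingL (nad (e a) (e b))).
  rewrite -[h' _ _]/(nad (grading (e a)) (e b) + nad (e a) (grading (e b))).
  have nadZl t u v : nad (t *: u) v = t *: nad u v.
    by rewrite nad_anti linearZ /= -scalerN -nad_anti.
  have nadZr t u v : nad u (t *: v) = t *: nad u v by rewrite linearZ.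
  rewrite !grading_e nadZl nadZr -scalerDl -rmorphD.
  have [->|[c [s [abc ->]]]] := nad_e a b; first by rewrite linear0 scaler0.
  by rewrite linearZ /= grading_e (WD abc) !scalerA mulrC.
rewrite -[h z u]/(gradingL (nad z u)) -[h u z]/(gradingL (nad u z)).
rewrite -[h' z u]/(nad (gradingL z) u + nad z (gradingL u)).
rewrite -[h' u z]/(nad (gradingL u) z + nad u (gradingL z)) => hE.
rewrite [nad u z]nad_anti linearN hE opprD -!nad_anti addrC.
by [].
Qed.
End RootVectors.
End Nilradical.

Lemma bound_nat (T : finType) (h : T -> nat) t : (h t <= \sum_s h s)%N.
Proof. by rewrite (bigD1 t) //= leq_addr. Qed.

Lemma pchar_intr_neq0 (F : fieldType) (p : nat) (z : int) :
  p \in [pchar F] -> z != 0 -> (absz z < p)%N -> z%:~R != 0 :> F.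
Proof.
move=> pF z0 zp.
have E : ((absz z)%:R == 0 :> F) = (z%:~R == 0 :> F).
  by case: z {z0 zp} => n //=; rewrite NegzE mulrNz oppr_eq0.
rewrite -E -(dvdn_pcharf pF) gtnNdvd //.
by rewrite absz_gt0.
Qed.

Theorem theorem1p1 :
  exists p0 : nat,
  forall (p : nat) (F : finFieldType), (p0 <= p)%N -> p \in [pchar F] ->
  forall (g : lieAlgebra F) (C : chevalley_basis g)
         (e : pos_root -> subvs_of (nilradical C)), root_vectors e ->
  forall l0 : ndual C,
  exists! l : ndual C, in_S e l /\ coadjoint_orbit l0 l.
Proof.
have [W [W0 Winj WD]] := integral_weight.
pose N := #|{: pos_root}|.
pose h1 a := (absz (W a)).+1.
pose h2 (ab : pos_root * pos_root) := (absz (W ab.1 - W ab.2)).+1.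
(* The summands bound the factorial indices, the weights and the differences of
   weights. *)
exists (N.*2.+4.+1 + \sum_a h1 a + \sum_ab h2 ab)%N.
move=> p F lep pF g C e e_root l0.
have small (m : nat) : (m <= N.*2.+4)%N -> (m < p)%N by lia.
have charL k : (k <= (\dim (nilradical C)).*2.+3)%N -> k.+1%:R != 0 :> F.
  rewrite dim_nilradical => lek; rewrite -(dvdn_pcharf pF) gtnNdvd //.
  exact: small.
have W0F a : (W a)%:~R != 0 :> F.
  apply: (pchar_intr_neq0 pF) => //.
  by apply: leq_trans (bound_nat h1 a) _; lia.
have WinjF : injective (fun a => (W a)%:~R : F).
  move=> a b /eqP; rewrite -subr_eq0 -rmorphB => ab0.
  apply/Winj/eqP; rewrite -subr_eq0; apply: contraTT ab0 => ab.
  apply: (pchar_intr_neq0 pF) => //.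
  by apply: leq_trans (bound_nat h2 (a, b)) _; lia.
have rlt a : (rank_of a < \dim (nilradical C))%N.
  by rewrite dim_nilradical rank_of_lt.
have coord_e : forall a b, root_coordL e a (e b) = (a == b)%:R := root_coord_e e_root.
have coordE : forall v, v = \sum_a root_coordL e a v *: e a := root_coordE e_root.
have nfP (l : ndual C) : normal_form rank_of e (@nad _ _ C) l <-> in_S e l.
  suff E a : same_rank rank_of e (@nad _ _ C) l a
      = (\rank (Amx e l a) == \rank (Bmx e l a)).
    split=> nl a; first by rewrite inE => /nl; rewrite E => /eqP.
    by move=> la; rewrite E; apply/eqP/nl; rewrite inE.
  have fromE : [set b | root_ge b a] = from rank_of a.
    by apply/setP => b; rewrite !inE root_ge_rank.
  have aboveE : [set b | root_gt b a] = above rank_of a.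
    by apply/setP => b; rewrite !inE root_gt_rank.
  by rewrite /Amx /Bmx fromE aboveE.
have [l [[nl [x lE]] uniq_l]] := orbit_normal_form charL rank_of_inj rlt coordE
  coord_e (@nad_anti _ _ C) (@nad_jacobi _ _ C) (nad_tri e_root)
  (grading_derivation e_root WD) (grading_e e_root W) W0F WinjF l0.
exists l; split; first by split; [apply/nfP | exists x].
by move=> m [/nfP nm [y mE]]; apply: uniq_l; split=> //; exists y.
Qed.
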